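(* Let $f=\bigoplus_{0\le i\le d} f_i\otimes y^{\otimes i}$, where $f_i=\bigoplus_J c_{i,J}\otimes x^{\otimes J}$, $0\le i\le d$, are tropical polynomials in the variables $x_1,\dots,x_n$ with integer coefficients, let the tropical Newton-Puiseux polynomial $y=\bigoplus_I a_I\otimes x^{\otimes I}$ be a resolution of $f$, and let $I$ be a multiindex from the support of $y$ such that the polyhedron $M_I\subset\mathbb{R}^n$ has full dimension $n$. Then the polyhedra $M_{I,i_1,I_1,i_2,I_2}$ having full dimension $n$ constitute a partition of $M_I$: their union is $M_I$, and every two of them either coincide or intersect in a set of dimension less than $n$.
   Context: In the tropical semiring $\oplus$ denotes $\min$ and $\otimes$ denotes classical addition $+$. A tropical polynomial in $x_1,\dots,x_n$ is a finite expression $\bigoplus_J c_J\otimes x^{\otimes J}$ with $J=(j_1,\dots,j_n)$ ranging over multiindices of nonnegative integers, regarded as the function $\mathbf x\mapsto\min_J\{c_J+j_1x_1+\cdots+j_nx_n\}$ on $\mathbb{R}^n$. A tropical Newton-Puiseux polynomial is a finite nonempty expression $\bigoplus_I a_I\otimes x^{\otimes I}$ with $I\in\mathbb{Q}^n$, $a_I\in\mathbb{Q}$, regarded as a function in the same way. It is a resolution of $f$ if for every $\mathbf x\in\mathbb{R}^n$ the minimum of the values $f_i(\mathbf x)+i\cdot y(\mathbf x)$, $0\le i\le d$, is finite and is attained for at least two different indices $i$. For $I$ in the support of $y$, $M_I\subset\mathbb{R}^n$ is the convex polyhedron of points at which the minimum of the monomials $\{a_J\otimes x^{\otimes J}\}_J$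 of $y$ is attained for $a_I\otimes x^{\otimes I}$. The polyhedra $M_{I,i_1,I_1,i_2,I_2}$ are defined for those $0\le i_1<i_2\le d$ and pairs of monomials $c_{i_1,I_1}\otimes x^{\otimes I_1}$ of $f_{i_1}$ and $c_{i_2,I_2}\otimes x^{\otimes I_2}$ of $f_{i_2}$ for which $$I_1+i_1\cdot I=I_2+i_2\cdot I,\qquad c_{i_1,I_1}+i_1\cdot a_I=c_{i_2,I_2}+i_2\cdot a_I,$$ i.e. the monomials $(c_{i_1,I_1}\otimes x^{\otimes I_1})\otimes(a_I\otimes x^{\otimes I})^{\otimes i_1}$ and $(c_{i_2,I_2}\otimes x^{\otimes I_2})\otimes(a_I\otimes x^{\otimes I})^{\otimes i_2}$ coincide. Then $M_{I,i_1,I_1,i_2,I_2}\subset M_I$ is the convex polyhedron of those points of $M_I$ at which the minimum of all the monomials $(c_{i,J}\otimes x^{\otimes J})\otimes(a_I\otimes x^{\otimes I})^{\otimes i}$, over all $0\le i\le d$ and all monomials $c_{i,J}\otimes x^{\otimes J}$ of $f_i$, is attained for $(c_{i_1,I_1}\otimes x^{\otimes I_1})\otimes(a_I\otimes x^{\otimes I})^{\otimes i_1}$. *)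

(* Defs.v *)
From mathcomp Require Import all_boot all_order all_algebra.
From mathcomp Require Import finmap boolp classical_sets reals constructive_ereal.

Set Implicit Arguments.
Unset Strict Implicit.
Unset Printing Implicit Defensive.

Import Order.TTheory GRing.Theory Num.Theory.

Local Open Scope classical_set_scope.
Local Open Scope ring_scope.

(* The finite map sends each multiindex J of the support to the coefficient
   c_J; the empty map, i.e. the constant +oo, is a tropical polynomial. *)
Definition trop_poly (n : nat) := {fmap 'rV[nat]_n -> int}.

(* The nonemptiness of a Newton-Puiseux polynomial is a separate hypothesis. *)
Definition trop_np_poly (n : nat) := {fmap 'rV[rat]_n -> rat}.

Definition expQ (n : nat) (J : 'rV[nat]_n) : 'rV[rat]_n :=
  map_mx (fun k : nat => k%:R) J.

Definition trop_mon (R : realType) (n : nat)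
    (a : rat) (I : 'rV[rat]_n) (x : 'rV[R]_n) : R :=
  ratr a + \sum_(k < n) ratr (I 0 k) * x 0 k.

Definition trop_eval (R : realType) (n : nat)
    (p : trop_poly n) (x : 'rV[R]_n) : \bar R :=
  \big[Order.min/+oo%E]_(J : domf p)
     (trop_mon (p J)%:~R (expQ (val J)) x)%:E.

Definition np_eval (R : realType) (n : nat)
    (y : trop_np_poly n) (x : 'rV[R]_n) : \bar R :=
  \big[Order.min/+oo%E]_(I : domf y) (trop_mon (y I) (val I) x)%:E.

Definition subst_val (R : realType) (n d : nat) (f : 'I_d.+1 -> trop_poly n)
    (y : trop_np_poly n) (i : 'I_d.+1) (x : 'rV[R]_n) : \bar R :=
  (trop_eval (f i) x + i%:R%:E * np_eval y x)%E.

Definition is_resolution (R : realType) (n d : nat)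
    (f : 'I_d.+1 -> trop_poly n) (y : trop_np_poly n) : Prop :=
  forall x : 'rV[R]_n,
    let m := \big[Order.min/+oo%E]_(i < d.+1) subst_val f y i x in
    (m \is a fin_num) /\
    exists i1 i2 : 'I_d.+1,
      [/\ i1 != i2, subst_val f y i1 x = m & subst_val f y i2 x = m].

Arguments is_resolution R {n d} f y.

(* The polyhedron M_I. *)
Definition np_cell (R : realType) (n : nat) (y : trop_np_poly n) (I : domf y) :
    set 'rV[R]_n :=
  [set x | forall J : domf y,
     trop_mon (y I) (val I) x <= trop_mon (y J) (val J) x].

Arguments np_cell R {n y} I.

(* Classically written, (c_{i,J} + <J, x>) + i (a_I + <I, x>): this gives the
   coefficient and the exponent vector of the substituted monomial. *)
Definition sub_coef (n d : nat) (f : 'I_d.+1 -> trop_poly n)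
    (y : trop_np_poly n) (I : domf y) (i : 'I_d.+1) (J : domf (f i)) : rat :=
  (f i J)%:~R + i%:R * y I.

Definition sub_exp (n d : nat) (f : 'I_d.+1 -> trop_poly n)
    (y : trop_np_poly n) (I : domf y) (i : 'I_d.+1) (J : domf (f i)) :
    'rV[rat]_n :=
  expQ (val J) + i%:R *: val I.

Definition sub_mon (R : realType) (n d : nat) (f : 'I_d.+1 -> trop_poly n)
    (y : trop_np_poly n) (I : domf y) (i : 'I_d.+1) (J : domf (f i))
    (x : 'rV[R]_n) : R :=
  trop_mon (sub_coef I J) (sub_exp I J) x.

(* The quadruples (i1, I1, i2, I2) for which M_{I,i1,I1,i2,I2} is defined. *)
Definition admissible (n d : nat) (f : 'I_d.+1 -> trop_poly n)
    (y : trop_np_poly n) (I : domf y) (i1 : 'I_d.+1) (I1 : domf (f i1))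
    (i2 : 'I_d.+1) (I2 : domf (f i2)) : Prop :=
  [/\ (i1 < i2)%N, sub_exp I I1 = sub_exp I I2 & sub_coef I I1 = sub_coef I I2].

(* The polyhedron M_{I,i1,I1,i2,I2}. The pair (i2, I2) does not occur in the
   body: on admissible quadruples its monomial is that of (i1, I1). *)
Definition sub_cell (R : realType) (n d : nat) (f : 'I_d.+1 -> trop_poly n)
    (y : trop_np_poly n) (I : domf y) (i1 : 'I_d.+1) (I1 : domf (f i1))
    (i2 : 'I_d.+1) (I2 : domf (f i2)) : set 'rV[R]_n :=
  [set x | np_cell R I x /\ forall (i : 'I_d.+1) (J : domf (f i)),
     sub_mon I I1 x <= sub_mon I J x].

Arguments sub_cell R {n d f y} I {i1} I1 {i2} I2.

Definition affinely_independent (R : realType) (n k : nat)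
    (p : 'I_k -> 'rV[R]_n) : Prop :=
  forall l : 'I_k -> R,
    \sum_(i < k) l i = 0 -> \sum_(i < k) l i *: p i = 0 -> forall i, l i = 0.

(* Dimension of the affine hull: one less than the maximal number of affinely
   independent points of S (at most n + 1 in R^n). The empty set has
   dimension -1, so it is not full-dimensional even in R^0. *)
Definition affdim (R : realType) (n : nat) (S : set 'rV[R]_n) : int :=
  (\max_(k < n.+2 | `[< exists p : 'I_k -> 'rV[R]_n,
      affinely_independent p /\ forall i, S (p i) >]) k)%:Z - 1.

Definition full_cells (R : realType) (n d : nat) (f : 'I_d.+1 -> trop_poly n)
    (y : trop_np_poly n) (I : domf y) : set (set 'rV[R]_n) :=
  [set P | exists (i1 : 'I_d.+1) (I1 : domf (f i1))
                  (i2 : 'I_d.+1) (I2 : domf (f i2)),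
     [/\ admissible I I1 I2, P = sub_cell R I I1 I2 & affdim P = n%:Z]].

Arguments full_cells R {n d} f {y} I.

(* Main.v *)
Require Import Defs.
From mathcomp Require Import all_boot all_order all_algebra.
From mathcomp Require Import finmap boolp classical_sets reals constructive_ereal.
From mathcomp Require Import polyrcf.

Import Order.TTheory GRing.Theory Num.Theory.

Local Open Scope classical_set_scope.
Local Open Scope ring_scope.

(** Monomials are affine functions on R^n, and both claims come from the study of
    the zeros and signs of their differences.

    Full dimension is a duality statement: a set S has dimension n iff the only
    affine form vanishing on S is zero (affdim_fullP). This settles the
    disjointness claim at once. On the intersection of two cells each of the two
    minimal monomials is at most the other, so their difference vanishes there;
    if the intersection is full-dimensional, the monomials are equal, and so are
    the cells.

    For the covering claim, let x0 be a point of M_I and pick affinely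
    independent points p_0, ..., p_n of M_I. The curve
      x(t) = x0 + t (p_0 - x0) + t^2 (p_1 - x0) + ... + t^(n+1) (p_n - x0)
    starts at x0 and, for small t > 0, stays in M_I, being made of convex
    combinations. A nonzero affine form restricts to a nonzero polynomial on it
    (form_poly_eq0), whose values have a constant nonzero sign for small t > 0. So there
    is an e > 0 such that on ]0, e[ all differences of substituted monomials have
    constant sign, zero only for equal monomials (sgr_germ). At one such point
    the resolution property gives two indices i1 < i2 and monomials attaining the
    minimum (resolution_pair); as their values agree there, the monomials
    coincide, i.e. the quadruple is admissible. By constancy of signs, the
    corresponding cell contains x(t) for all t in ]0, e[, and x0 in the limit. An
    affine form vanishing on this cell vanishes on an arc of the curve, so it is
    zero, and the cell has full dimension (full_cell_at). *)

(** * Affine forms *)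

(** An affine form is coded by its constant term and its linear part, so that
    forms can be subtracted and equality of forms is equality of coefficients. *)
Definition aff {R : realType} {n : nat} (u : R * 'rV[R]_n) (x : 'rV[R]_n) : R :=
  u.1 + \sum_(k < n) u.2 0 k * x 0 k.

Lemma affB {R : realType} {n : nat} (u w : R * 'rV[R]_n) (x : 'rV[R]_n) :
  aff (u - w) x = aff u x - aff w x.
Proof.
rewrite /aff /= opprD addrACA; congr (_ + _).
by rewrite -sumrB; apply: eq_bigr => k _; rewrite !mxE mulrBl.
Qed.

Lemma aff_comb {R : realType} {n m : nat} (u : R * 'rV[R]_n)
    (l : 'I_m -> R) (p : 'I_m -> 'rV[R]_n) :
  \sum_i l i * aff u (p i) =
    u.1 * (\sum_i l i) + \sum_(k < n) u.2 0 k * (\sum_i l i *: p i) 0 k.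
Proof.
under eq_bigr do rewrite /aff mulrDr.
rewrite big_split /= mulr_sumr; congr (_ + _).
  by apply: eq_bigr => i _; rewrite mulrC.
under eq_bigr do rewrite mulr_sumr.
rewrite exchange_big; apply: eq_bigr => k _ /=.
rewrite summxE mulr_sumr; apply: eq_bigr => i _.
by rewrite mxE mulrCA.
Qed.

(** * Full dimension and vanishing affine forms *)

(** Affine independence of points is linear independence of these rows, and an
    affine form is a linear form on them, given by the column [form_col]. *)
Definition homog {R : realType} {n m : nat} (p : 'I_m -> 'rV[R]_n) :
    'M[R]_(m, 1 + n) := \matrix_i row_mx 1 (p i).

Definition form_col {R : realType} {n : nat} (u : R * 'rV[R]_n) : 'cV[R]_(1 + n) :=
  col_mx (u.1)%:M (u.2)^T.

Lemma homog_mul_form {R : realType} {n m : nat} (p : 'I_m -> 'rV[R]_n)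
    (u : R * 'rV[R]_n) (i : 'I_m) :
  (homog p *m form_col u) i 0 = aff u (p i).
Proof.
have -> : (homog p *m form_col u) i 0 = (row i (homog p) *m form_col u) 0 0.
  by rewrite -row_mul [RHS]mxE.
rewrite rowK mul_row_col mxE mul1mx [X in X + _]mxE mulr1n; congr (_ + _).
by rewrite mxE; apply: eq_bigr => k _; rewrite mxE mulrC.
Qed.

Lemma affinely_independent_row_free {R : realType} {n m : nat}
    (p : 'I_m -> 'rV[R]_n) :
  affinely_independent p -> row_free (homog p).
Proof.
move=> ind; apply: inj_row_free => w.
rewrite mulmx_sum_row; under eq_bigr do rewrite rowK scale_row_mx.
move=> wp; apply/rowP => i; rewrite [RHS]mxE; apply: (ind (w 0)).
  have := congr1 (fun M : 'rV_(1 + n) => lsubmx M 0 0) wp.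
  rewrite linear_sum summxE linear0 [RHS]mxE; apply: etrans.
  by apply: eq_bigr => k _ /=; rewrite row_mxKl !mxE mulr1.
have := congr1 (fun M : 'rV_(1 + n) => rsubmx M) wp.
rewrite linear_sum linear0; apply: etrans.
by apply: eq_bigr => k _ /=; rewrite row_mxKr.
Qed.

Lemma affinely_independent_form0 {R : realType} {n : nat}
    (p : 'I_n.+1 -> 'rV[R]_n) (u : R * 'rV[R]_n) :
  affinely_independent p -> (forall i, aff u (p i) = 0) -> u = 0.
Proof.
move=> /affinely_independent_row_free; rewrite row_free_unit => unitA up.
have /(congr1 (mulmx (invmx (homog p)))) : homog p *m form_col u = 0.
  by apply/colP => i; rewrite homog_mul_form up mxE.
rewrite mulKmx // mulmx0 => u0; have /eqP : form_col u = 0 by [].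
rewrite col_mx_eq0 => /andP[/eqP u1 /eqP u2].
case: u {up u0} u1 u2 => c v /= c0 v0; congr (_, _).
  by move/matrixP/(_ 0 0): c0; rewrite !mxE mulr1n.
by rewrite -[v]trmxK v0 trmx0.
Qed.

(** At most n points give at most n rows in dimension n + 1, so the matrix has a
    nonzero right kernel vector, to be read as an affine form. *)
Lemma vanishing_form {R : realType} {n m : nat} (p : 'I_m -> 'rV[R]_n) :
  (m <= n)%N -> exists2 u, u != 0 & forall i, aff u (p i) = 0.
Proof.
move=> le_mn.
have : cokermx (homog p) != 0.
  rewrite cokermx_eq0 /row_full neq_ltn; apply/orP; left.
  by apply: leq_ltn_trans (rank_leq_row _) _; rewrite add1n ltnS.
case/matrix0Pn => i [j nz_ij].
set w : 'cV_(1 + n) := col j (cokermx (homog p)).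
have wE : form_col (w 0 0, (dsubmx w)^T) = w.
  rewrite -[RHS]vsubmxK /form_col /= trmxK; congr col_mx.
  apply/matrixP => a b; rewrite !ord1 [RHS]mxE mxE mulr1n.
  by congr (w _ _); apply/val_inj.
exists (w 0 0, (dsubmx w)^T) => [|k]; last first.
  by rewrite -homog_mul_form wE /w colE mulmxA mulmx_coker mul0mx mxE.
apply: contraNneq nz_ij => u0; rewrite -[_ i j]/((cokermx (homog p)) i j).
have : w i 0 = 0.
  by rewrite -wE u0 /form_col /= trmx0 (rmorph0 (@scalar_mx _ 1)) col_mx0 mxE.
by rewrite mxE => ->.
Qed.

Lemma affdim_le {R : realType} {n : nat} (S : set 'rV[R]_n) : affdim S <= n%:Z.
Proof.
rewrite /affdim lerBlDr -PoszD lez_nat addn1.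
by apply/bigmax_leqP => k _; rewrite -ltnS.
Qed.

Lemma affdim_full_points {R : realType} {n : nat} (S : set 'rV[R]_n) :
  affdim S = n%:Z <->
  exists p : 'I_n.+1 -> 'rV[R]_n, affinely_independent p /\ forall i, S (p i).
Proof.
split=> [dimS|Sp]; last first.
  apply/le_anti; rewrite affdim_le /affdim lerBrDr -PoszD lez_nat addn1.
  by apply: (@leq_bigmax_cond _ _ _ (@ord_max n.+1)); apply/asboolP.
apply: contrapT => noSp; move/eqP: dimS; apply/negP.
rewrite neq_lt /affdim ltrBlDr -PoszD ltz_nat addn1 ltnS.
apply/orP; left; apply/bigmax_leqP => k /asboolP Sk.
rewrite -ltnS ltn_neqAle -ltnS ltn_ord andbT; apply/eqP => kE.
by apply: noSp; rewrite -kE.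
Qed.

(** If only the zero form vanishes on S, independent points of S can be added
    one by one: while there are at most n of them, a nonzero form vanishes on
    them all, and any point of S where it does not vanish is independent of
    them. *)
Lemma affdim_fullP {R : realType} {n : nat} (S : set 'rV[R]_n) :
  affdim S = n%:Z <-> forall u, (forall x, S x -> aff u x = 0) -> u = 0.
Proof.
rewrite affdim_full_points; split=> [[p [ind Sp]] u uS|S_spans].
  by apply: affinely_independent_form0 ind _ => i; apply: uS.
suff H m : (m <= n.+1)%N -> exists p : 'I_m -> 'rV[R]_n,
    affinely_independent p /\ forall i, S (p i) by exact: H.
elim: m => [_|m IHm lt_mn]; first by exists (fun=> 0); split=> [l _ _|] [].
have [p [ind Sp]] := IHm (ltnW lt_mn).
have [u nz_u up] := vanishing_form p lt_mn.
have [x Sx ux] : exists2 x, S x & aff u x != 0.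
  apply: contrapT => nox; move/eqP: nz_u; apply; apply: S_spans => x Sx.
  by apply/eqP; apply: contrapT => /negP ux; apply: nox; exists x.
pose q (i : 'I_m.+1) := if unlift ord0 i is Some j then p j else x.
have q0 : q ord0 = x by rewrite /q unlift_none.
have qS j : q (lift ord0 j) = p j by rewrite /q liftK.
exists q; split; last by move=> i; rewrite /q; case: unliftP.
move=> l sum_l sum_lq.
(* The form u kills all the points but x, which isolates the coefficient of x. *)
have l0 : l ord0 = 0.
  have /eqP : \sum_i l i * aff u (q i) = 0.
    rewrite aff_comb sum_l sum_lq mulr0 add0r big1 // => k _.
    by rewrite mxE mulr0.
  rewrite big_ord_recl big1 => [|j _]; last by rewrite qS up mulr0.
  by rewrite addr0 q0 mulf_eq0 (negPf ux) orbF => /eqP.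
have lS : forall j, l (lift ord0 j) = 0.
  apply: (ind (fun j => l (lift ord0 j))).
    by rewrite big_ord_recl l0 add0r in sum_l.
  rewrite big_ord_recl l0 scale0r add0r in sum_lq.
  by under eq_bigr do rewrite -qS.
by move=> i; case: (unliftP ord0 i) => [j|] ->.
Qed.

(** * Signs of polynomials to the right of zero *)

(** Each of the nonzero polynomials has finitely many roots, so all signs are
    constant on a common interval on the right of 0. *)
Lemma sgr_germ {R : realType} (s : seq {poly R}) :
  exists2 e : R, 0 < e & forall t, 0 < t < e ->
    forall p, p \in s -> Num.sg p.[t] = sgp_right p 0.
Proof.
elim: s => [|p s [e e_gt0 IHs]]; first by exists 1.
have [d d_gt0 dP] : exists2 d : R, 0 < d & forall t, 0 < t < d ->
    Num.sg p.[t] = sgp_right p 0.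
  have [->|nz_p] := eqVneq p 0.
    by exists 1 => // t _; rewrite horner0 sgp_right0 sgr0.
  have [w] := neighpr_wit (@ltr01 R) nz_p.
  rewrite /neighpr inE /= => /andP[w_gt0 w_lt].
  exists (next_root p 0 1) => [|t t_in]; first exact: lt_trans w_lt.
  by apply: (@sgr_neighpr _ 1); rewrite inE.
exists (Num.min d e) => [|t]; first by rewrite lt_min d_gt0.
rewrite lt_min => /and3P[t_gt0 td te] q; rewrite inE => /predU1P[->|/IHs->//].
  by apply: dP; rewrite t_gt0.
by rewrite t_gt0.
Qed.

(** A weak inequality valid just to the right of x passes to the limit at x. *)
Lemma sgp_right_le0 {R : realType} (p : {poly R}) (x : R) :
  sgp_right p x <= 0 -> p.[x] <= 0.
Proof.
have [/rootP-> //|nroot] := boolP (root p x).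
by rewrite sgp_rightNroot // sgr_le0.
Qed.

(** * A generic curve *)

(** The distinct positive powers of t keep the coefficients of the directions
    p k - x0 apart, so that an affine form vanishing along the curve must vanish
    at x0 and at every p k. *)
Definition curve {R : realType} {n m : nat} (x0 : 'rV[R]_n)
    (p : 'I_m -> 'rV[R]_n) (t : R) : 'rV[R]_n :=
  x0 + \sum_(k < m) t ^+ k.+1 *: (p k - x0).

Definition form_poly {R : realType} {n m : nat} (x0 : 'rV[R]_n)
    (p : 'I_m -> 'rV[R]_n) (u : R * 'rV[R]_n) : {poly R} :=
  (aff u x0)%:P + \sum_(k < m) (aff u (p k) - aff u x0) *: 'X^(k.+1).

Lemma aff_curve {R : realType} {n m : nat} (x0 : 'rV[R]_n)
    (p : 'I_m -> 'rV[R]_n) (u : R * 'rV[R]_n) (t : R) :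
  aff u (curve x0 p t) = (form_poly x0 p u).[t].
Proof.
rewrite /form_poly hornerD hornerC horner_sum.
under [in RHS]eq_bigr do rewrite hornerZ hornerXn mulrC.
pose v : R * 'rV[R]_n := (0, u.2).
have affE z w : aff u (z + w) = aff u z + aff v w.
  rewrite /aff /= add0r -addrA; congr (_ + _); rewrite -big_split /=.
  by apply: eq_bigr => k _; rewrite mxE mulrDr.
rewrite /curve affE; congr (_ + _).
have -> : aff v (\sum_(k < m) t ^+ k.+1 *: (p k - x0)) =
    \sum_(k < m) t ^+ k.+1 * aff v (p k - x0).
  by rewrite aff_comb mul0r.
apply: eq_bigr => k _; congr (_ * _).
by rewrite -[in RHS](subrKC x0 (p k)) affE addrAC subrr add0r.
Qed.

(** The coefficients of the polynomial determine the values of u at x0 and at the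
    n + 1 independent points p i, hence u itself. *)
Lemma form_poly_eq0 {R : realType} {n : nat} (x0 : 'rV[R]_n)
    (p : 'I_n.+1 -> 'rV[R]_n) (u : R * 'rV[R]_n) :
  affinely_independent p -> form_poly x0 p u = 0 -> u = 0.
Proof.
move=> ind pu0; apply: (affinely_independent_form0 p) => // i.
have coefE j : (form_poly x0 p u)`_j = 0 by rewrite pu0 coef0.
have u0 : aff u x0 = 0.
  have := coefE 0; rewrite coefD coefC /= coef_sum big1 ?addr0 // => k _.
  by rewrite coefZ coefXn mulr0.
have := coefE i.+1; rewrite coefD coefC /= add0r coef_sum (bigD1 i) //=.
rewrite big1 ?addr0 => [|k ki].
  by rewrite coefZ coefXn eqxx mulr1 u0 subr0.
rewrite coefZ coefXn eqSS; case: eqP => [/val_inj ik|_]; last by rewrite mulr0.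
by rewrite ik eqxx in ki.
Qed.

Lemma form_poly0 {R : realType} {n m : nat} (x0 : 'rV[R]_n)
    (p : 'I_m -> 'rV[R]_n) (u : R * 'rV[R]_n) :
  (form_poly x0 p u).[0] = aff u x0.
Proof.
rewrite -aff_curve; congr (aff u _); rewrite /curve big1 ?addr0 // => k _.
by rewrite expr0n scale0r.
Qed.

(** For small t the weights 1 - t - ... - t^m, t, ..., t^m are nonnegative with
    sum 1. Stated for forms rather than sets, since a cell is the locus where
    finitely many forms are nonnegative. *)
Lemma curve_convex {R : realType} {n m : nat} :
  exists2 e : R, 0 < e & forall (x0 : 'rV[R]_n) (p : 'I_m -> 'rV[R]_n)
    (u : R * 'rV[R]_n) (t : R), 0 < t < e ->
    0 <= aff u x0 -> (forall k, 0 <= aff u (p k)) -> 0 <= aff u (curve x0 p t).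
Proof.
pose q : {poly R} := 1 - \sum_(k < m) 'X^(k.+1).
have q0 : q.[0] = 1.
  rewrite hornerD hornerN hornerC horner_sum big1 ?subr0 // => k _.
  by rewrite hornerXn expr0n.
have [e e_gt0 eP] := sgr_germ [:: q]; exists e => // x0 p u t t_in u0 up.
have q_gt0 : 0 < q.[t].
  rewrite -sgr_gt0 (eP _ t_in) ?mem_head // sgp_rightNroot.
    by rewrite q0 sgr1.
  by rewrite rootE q0 oner_eq0.
have -> : aff u (curve x0 p t) =
    q.[t] * aff u x0 + \sum_(k < m) t ^+ k.+1 * aff u (p k).
  rewrite aff_curve /form_poly /q !(hornerD, hornerN) !hornerC !horner_sum.
  move: (aff u x0) => a; rewrite mulrBl mul1r -addrA; congr (_ + _).
  rewrite mulr_suml -sumrN -big_split /=; apply: eq_bigr => k _.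
  by rewrite hornerZ !hornerXn [LHS]mulrC mulrBr addrC.
case/andP: t_in => t_gt0 _.
rewrite addr_ge0 ?mulr_ge0 ?(ltW q_gt0) // sumr_ge0 // => k _.
by rewrite mulr_ge0 // exprn_ge0 // ltW.
Qed.

(** * Tropical monomials and the resolution property *)

Definition mon_form {R : realType} {n : nat} (a : rat) (I : 'rV[rat]_n) :
    R * 'rV[R]_n := (ratr a, map_mx ratr I).

Lemma aff_mon_form {R : realType} {n : nat} (a : rat) (I : 'rV[rat]_n)
    (x : 'rV[R]_n) : aff (mon_form a I) x = trop_mon a I x.
Proof. by congr (_ + _); apply: eq_bigr => k _; rewrite mxE. Qed.

Lemma mon_form_inj {R : realType} {n : nat} (a b : rat) (I J : 'rV[rat]_n) :
  mon_form a I = mon_form b J :> R * 'rV[R]_n -> a = b /\ I = J.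
Proof.
case=> /fmorph_inj -> /matrixP eqIJ; split=> //; apply/matrixP => i j.
by have := eqIJ i j; rewrite !mxE => /fmorph_inj.
Qed.

Lemma bigmin_attained {R : realType} {T : finType} (F : T -> \bar R) :
  let m := \big[Order.min/+oo%E]_t F t in
  m = +oo%E \/ exists t, F t = m.
Proof.
move=> m; have [[t _]|noT] := pselect (exists t : T, true).
  right; rewrite /m.
  have [s _ ->] := eq_bigmin t xpredT (fun i => F i) isT (fun i _ => leey _).
  by exists s.
by left; rewrite /m big1 // => t; case: noT; exists t.
Qed.

Lemma np_eval_cell {R : realType} {n : nat} {y : trop_np_poly n} {I : domf y}
    {x : 'rV[R]_n} :
  np_cell R I x -> np_eval y x = (trop_mon (y I) (val I) x)%:E.
Proof.
move=> xI; apply/le_anti; rewrite /np_eval bigmin_le /=.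
by apply/bigmin_geP; split=> [|J _]; rewrite ?leey // lee_fin.
Qed.

Lemma sub_monE {R : realType} {n d : nat} (f : 'I_d.+1 -> trop_poly n)
    (y : trop_np_poly n) (I : domf y) (i : 'I_d.+1) (J : domf (f i))
    (x : 'rV[R]_n) :
  sub_mon I J x =
    trop_mon (f i J)%:~R (expQ (val J)) x + i%:R * trop_mon (y I) (val I) x.
Proof.
rewrite /sub_mon /sub_coef /sub_exp /trop_mon rmorphD rmorphM /= ratr_nat.
rewrite mulrDr addrACA; congr (_ + _).
rewrite mulr_sumr -big_split /=; apply: eq_bigr => k _.
by rewrite !mxE rmorphD rmorphM /= !ratr_nat mulrDl -[_ * _ * x 0 k]mulrA.
Qed.

(** On M_I the value of y is that of its monomial at I, so f_i + i y is the
    minimum of the substituted monomials with index i, and the two indices given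
    by the resolution turn into two monomials of minimal value. *)
Lemma resolution_pair {R : realType} {n d : nat} {f : 'I_d.+1 -> trop_poly n}
    {y : trop_np_poly n} {I : domf y} {x : 'rV[R]_n} :
  is_resolution R f y -> np_cell R I x ->
  exists (i1 : 'I_d.+1) (I1 : domf (f i1)) (i2 : 'I_d.+1) (I2 : domf (f i2)),
    [/\ (i1 < i2)%N, sub_mon I I1 x = sub_mon I I2 x
      & forall i (J : domf (f i)), sub_mon I I1 x <= sub_mon I J x].
Proof.
move=> /(_ x) /=; set m := \big[_/_]_(i < _) _.
case=> m_fin [i1 [i2 [ne12 m1 m2]]] xI.
have m_le i (J : domf (f i)) : (m <= (sub_mon I J x)%:E)%E.
  apply: le_trans (bigmin_le _ i _) _.
  rewrite /subst_val (np_eval_cell xI) sub_monE -EFinM.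
  by rewrite [leRHS]EFinD; apply: leeD => //; apply: bigmin_le.
(* Finiteness of m excludes the constant +oo, i.e. f_i without monomials. *)
have m_att i : subst_val f y i x = m ->
    exists J : domf (f i), m = (sub_mon I J x)%:E.
  move=> mi; rewrite -mi in m_fin *; move: m_fin.
  rewrite /subst_val (np_eval_cell xI) /trop_eval.
  have [->|[J <-] _] := bigmin_attained
      (fun J : domf (f i) => (trop_mon (f i J)%:~R (expQ (val J)) x)%:E) => //.
  by exists J; rewrite sub_monE.
wlog lt12 : i1 i2 ne12 m1 m2 / (i1 < i2)%N.
  move=> W; move: (ne12); rewrite neq_ltn => /orP[|] lt; first exact: (W i1 i2).
  by apply: (W i2 i1) => //; rewrite eq_sym.
have [I1 mI1] := m_att _ m1; have [I2 mI2] := m_att _ m2.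
exists i1, I1, i2, I2; split=> // [|i J].
  by apply: EFin_inj; rewrite -mI1.
by rewrite -lee_fin -mI1.
Qed.

(** * The cells *)

(** The cell is the one whose monomial is minimal on the curve just after x0. *)
Lemma full_cell_at {R : realType} {n d : nat} (f : 'I_d.+1 -> trop_poly n)
    (y : trop_np_poly n) (I : domf y) (x0 : 'rV[R]_n) :
  is_resolution R f y -> affdim (np_cell R I) = n%:Z -> np_cell R I x0 ->
  exists2 P, full_cells R f I P & P x0.
Proof.
move=> y_res /affdim_full_points[p [ind pI]] x0I.
have [e1 e1_gt0 e1P] := @curve_convex R n n.+1.
pose T : finType := {i : 'I_d.+1 & domf (f i)}.
pose F (a : T) : R * 'rV[R]_n :=
  mon_form (sub_coef I (tagged a)) (sub_exp I (tagged a)).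
have FE a x : aff (F a) x = sub_mon I (tagged a) x by apply: aff_mon_form.
pose q (a b : T) := form_poly x0 p (F a - F b).
have [e2 e2_gt0 e2P] := sgr_germ [seq q a b | a <- enum T, b <- enum T].
have {}e2P t a b : 0 < t < e2 ->
    Num.sg (aff (F a - F b) (curve x0 p t)) = sgp_right (q a b) 0.
  move=> t_in; rewrite aff_curve; apply: e2P => //.
  by apply/allpairsP; exists (a, b); rewrite !mem_enum.
pose e := Num.min e1 e2.
have e_gt0 : 0 < e by rewrite lt_min e1_gt0.
have e_in t : 0 < t < e -> 0 < t < e1 /\ 0 < t < e2.
  by rewrite lt_min => /and3P[-> -> ->].
have curveI t : 0 < t < e -> np_cell R I (curve x0 p t).
  case/e_in=> t_in _ J; rewrite -!aff_mon_form -subr_ge0 -affB.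
  apply: e1P => // [|k]; rewrite affB subr_ge0 !aff_mon_form; first exact: x0I.
  exact: pI.
have half_in (r : R) : 0 < r -> 0 < r / 2 < r.
  move=> r_gt0; rewrite divr_gt0 ?ltr0n // ltr_pdivrMr ?ltr0n //.
  by rewrite mulr_natr mulr2n ltrDl.
have t0_in := half_in _ e_gt0.
have [i1 [I1 [i2 [I2 [lt12 eq12 min1]]]]] :=
  resolution_pair y_res (curveI _ t0_in).
pose a1 : T := Tagged _ I1; pose a2 : T := Tagged _ I2.
(* Equal values at a generic point force equal monomials. *)
have eqF : F a1 = F a2.
  apply/eqP; rewrite -subr_eq0; apply/eqP/(form_poly_eq0 x0 p) => //.
  have [_ t0_in2] := e_in _ t0_in; apply/eqP.
  by rewrite -(sgp_right_eq0 0) -(e2P _ a1 a2 t0_in2) affB !FE eq12 subrr sgr0.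
(* Minimality at a single generic point is minimality along the whole arc. *)
have sgp_min b : sgp_right (q a1 b) 0 <= 0.
  have [_ t0_in2] := e_in _ t0_in.
  by rewrite -(e2P _ a1 b t0_in2) sgr_le0 affB !FE subr_le0 min1.
exists (sub_cell R I I1 I2); last first.
  split=> // i J; have := sgp_right_le0 _ _ (sgp_min (Tagged _ J)).
  by rewrite form_poly0 affB !FE subr_le0.
exists i1, I1, i2, I2; split=> //.
  by have [] := mon_form_inj _ _ _ _ eqF.
apply/affdim_fullP => u u0; apply: (form_poly_eq0 x0 p) => //.
have [e3 e3_gt0 e3P] := sgr_germ [:: form_poly x0 p u].
have [t t_in t_in3] : exists2 t, 0 < t < e & 0 < t < e3.
  have : 0 < Num.min e e3 by rewrite lt_min e_gt0.
  move=> /half_in/andP[t_gt0]; rewrite lt_min => /andP[te te3].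
  by exists (Num.min e e3 / 2); rewrite t_gt0.
apply/eqP; rewrite -(sgp_right_eq0 0) -(e3P t t_in3) ?mem_head // -aff_curve.
rewrite u0 ?sgr0 //; split=> [|i J]; first exact: curveI.
have [_ t_in2] := e_in _ t_in.
rewrite -subr_le0 -(FE a1) -(FE (Tagged _ J)) -affB -sgr_le0.
by rewrite (e2P _ _ _ t_in2).
Qed.

Theorem lemma1p9 (R : realType) (n d : nat) (f : 'I_d.+1 -> trop_poly n)
    (y : trop_np_poly n) (y_nonempty : y <> [fmap]%fmap)
    (y_resolution : is_resolution R f y)
    (I : domf y) (I_full : affdim (np_cell R I) = n%:Z) :
  \bigcup_(P in full_cells R f I) P = np_cell R I /\
  forall P Q : set 'rV[R]_n, full_cells R f I P -> full_cells R f I Q ->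
    P = Q \/ affdim (P `&` Q) < n%:Z.
Proof.
split.
  apply/seteqP; split=> [x [P [i1 [I1 [i2 [I2 [_ -> _]]]]] []] //|x xI].
  have [P fullP Px] := full_cell_at f y I x y_resolution I_full xI.
  by exists P.
move=> P Q [i1 [I1 [i2 [I2 [_ PE _]]]]] [j1 [J1 [j2 [J2 [_ QE _]]]]].
have [dimPQ|] := eqVneq (affdim (P `&` Q)) n%:Z; last first.
  by move=> neq; right; rewrite lt_neqAle neq affdim_le.
left; move/affdim_fullP: dimPQ => spanPQ.
have eqF : mon_form (sub_coef I I1) (sub_exp I I1) =
    mon_form (sub_coef I J1) (sub_exp I J1) :> R * 'rV[R]_n.
  apply/eqP; rewrite -subr_eq0; apply/eqP/spanPQ => x.
  rewrite PE QE => -[[_ xI1] [_ xJ1]]; apply/eqP; rewrite affB !aff_mon_form.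
  by rewrite subr_eq0 eq_le xI1 xJ1.
have eqmon x : sub_mon I I1 x = sub_mon I J1 x :> R.
  by rewrite /sub_mon -!aff_mon_form eqF.
by rewrite PE QE; apply/seteqP; split=> x [xI xmin]; split=> // i J;
   have := xmin i J; rewrite eqmon.
Qed.
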